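(* Let $X$ be a compact Hausdorff space, let $n\in\mathbb{N}$, and let $F:(C_+(X))^n\to[0,\infty)$ be additive. Then there is a finite Radon measure $\mu$ in $X^n$ such that $$F(f_1,\dots,f_n)=\int_{X^n}f_1(x_1)\cdots f_n(x_n)\,d\mu(x_1,\dots,x_n)$$ for all $(f_1,\dots,f_n)\in(C_+(X))^n$.
   Context: $C_+(X)$ is the set of nonnegative continuous real-valued functions on $X$. $F$ is additive if it is additive in each variable: for each $i$, $F(f_1,\dots,f_{i-1},f_i+g_i,f_{i+1},\dots,f_n)=F(f_1,\dots,f_n)+F(f_1,\dots,f_{i-1},g_i,f_{i+1},\dots,f_n)$ for all $f_1,\dots,f_n,g_i\in C_+(X)$. *)

(* Defs.v *)
From HB Require Import structures.
From mathcomp Require Import all_boot all_order all_algebra.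
From mathcomp Require Import all_classical all_reals all_analysis.
Import Order.TTheory GRing.Theory Num.Theory.
Import numFieldNormedType.Exports.

Set Implicit Arguments.
Unset Strict Implicit.
Unset Printing Implicit Defensive.

Local Open Scope classical_set_scope.
Local Open Scope ring_scope.

Record Cplus (X : topologicalType) (R : realType) := MkCplus {
  Cplus_fun :> X -> R;
  Cplus_continuous : continuous Cplus_fun;
  Cplus_ge0 : forall x, 0 <= Cplus_fun x }.

Section Cplus_add.
Variables (X : topologicalType) (R : realType) (f g : Cplus X R).

Let add_continuous : continuous (fun x => f x + g x).
Proof. by move=> x; apply: cvgD; exact: Cplus_continuous. Qed.

Let add_ge0 x : 0 <= f x + g x.
Proof. by rewrite addr_ge0 // Cplus_ge0. Qed.

Definition Cplus_add : Cplus X R := MkCplus add_continuous add_ge0.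

End Cplus_add.

(* [dfwith f i h] is the tuple f with its i-th entry replaced by h. *)
Definition multiadditive (X : topologicalType) (R : realType) (n : nat)
    (F : ('I_n -> Cplus X R) -> R) : Prop :=
  forall (i : 'I_n) (f : 'I_n -> Cplus X R) (g : Cplus X R),
    F (dfwith f i (Cplus_add (f i) g)) = F f + F (dfwith f i g).

(* A measurableType has to be pointed, and an arbitrary topological space need
   not be inhabited: [pointed_at p] is the space T with p as its default point.
   Neither the topology nor the Borel sets depend on p. *)
Definition pointed_at (T : topologicalType) (p : T) : Type := T.

HB.instance Definition _ (T : topologicalType) (p : T) :=
  Topological.on (pointed_at p).
HB.instance Definition _ (T : topologicalType) (p : T) :=
  isPointed.Build (pointed_at p) p.

Notation borelType T := (g_sigma_algebraType (@open T)).

(* Meant for Hausdorff T, where compact sets are Borel. *)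
Definition radon (R : realType) (T : ptopologicalType)
    (mu : set (borelType T) -> \bar R) : Prop :=
  (forall x : T, exists2 U : set T, open_nbhs x U & (mu U < +oo)%E) /\
  (forall A : set (borelType T), measurable A ->
    mu A = ereal_sup [set mu K | K in [set K : set T | compact K /\ K `<=` A]]).

(* Main.v *)
Require Import Defs.
From HB Require Import structures.
From mathcomp Require Import all_boot all_order all_algebra.
From mathcomp Require Import all_classical all_reals all_analysis.
From mathcomp Require Import finmap measurable_realfun ring lra.
Import Order.TTheory GRing.Theory Num.Theory.
Import numFieldNormedType.Exports.

Set Implicit Arguments.
Unset Strict Implicit.
Unset Printing Implicit Defensive.

Local Open Scope classical_set_scope.
Local Open Scope ring_scope.

(** The proof constructs a positive additive functional on the nonnegative
    continuous functions of X^n that takes the value F (f_1, ..., f_n) on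
    f_1(x_1) ... f_n(x_n), and then represents that functional by a measure.

    Write f_1 (x) ... (x) f_n for the function of X^n with value
    f_1(x_1) ... f_n(x_n).  The crux is that F is positive on tensors: if a
    finite real combination sum_k c_k f_k1 (x) ... (x) f_kn is nonnegative on
    X^n, then sum_k c_k F (f_k) >= 0 [multiadditive_positivity].  The points
    x_1, ..., x_n are replaced by slots of F one at a time, and each
    replacement is a statement about a single variable
    [positive_combination]: if sum_k c_k f_k(x) L_k(h) >= 0 for all x and h,
    with L_k additive and nonnegative, then sum_k c_k L_k(f_k) >= 0.  It holds
    because a fine partition of unity (phi_a) makes L_k(f_k) nearly equal to
    sum_a f_k(x_a) L_k(phi_a).

    Partitions of unity also show that combinations of tensors are uniformly
    dense among the continuous functions on X^n [tensor_approximation], by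
    compactness of X^n and because continuous functions separate the points of
    X.  Hence g |-> inf { sum_k c_k F (f_k) | g <= sum_k c_k (x)_i f_ki } is
    additive [tensor_extension_pa], and positivity makes it agree with F on
    tensors [tensor_extensionE].

    What remains is the Riesz representation theorem for a compact Hausdorff
    space [riesz_representation].  The content of an open set V is the supremum
    of L f over continuous f <= 1_V; the outer measure it induces makes open
    sets measurable in the sense of Caratheodory, and its restriction to Borel
    sets is a Radon measure.  Both L and the integral are squeezed by this
    content on open sets, which determines them [sandwich_unique]. *)

(** * Operations on nonnegative continuous functions *)

Section Cplus_operations.
Variables (X : topologicalType) (R : realType).
Implicit Types f g h : Cplus X R.

Let cst_continuous (c : R) : continuous (fun _ : X => c).
Proof. by move=> x; exact: cvg_cst. Qed.

Definition Cplus_cst (c : R) (c_ge0 : 0 <= c) : Cplus X R :=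
  MkCplus (@cst_continuous c) (fun=> c_ge0).

Let mul_continuous f g : continuous (fun x => f x * g x).
Proof. by move=> x; apply: cvgM; exact: Cplus_continuous. Qed.

Let mul_ge0 f g x : 0 <= f x * g x.
Proof. by rewrite mulr_ge0 // Cplus_ge0. Qed.

Definition Cplus_mul f g : Cplus X R :=
  MkCplus (@mul_continuous f g) (@mul_ge0 f g).

Let sub_continuous f g : continuous (fun x => f x - g x).
Proof. by move=> x; apply: cvgB; exact: Cplus_continuous. Qed.

Let sub_ge0 f g (le_gf : forall x, g x <= f x) x : 0 <= f x - g x.
Proof. by rewrite subr_ge0. Qed.

Definition Cplus_sub f g (le_gf : forall x, g x <= f x) : Cplus X R :=
  MkCplus (@sub_continuous f g) (sub_ge0 le_gf).

Let pos_continuous (c : R) f : continuous (fun x => Num.max (f x - c) 0).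
Proof.
move=> x; apply: (@continuous_max R X (fun x => f x - c) (fun=> 0)); last exact: cvg_cst.
by apply: cvgB; [exact: Cplus_continuous | exact: cvg_cst].
Qed.

Let pos_ge0 (c : R) f x : 0 <= Num.max (f x - c) 0.
Proof. by rewrite le_max lexx orbT. Qed.

Definition Cplus_cut (c : R) f : Cplus X R :=
  MkCplus (@pos_continuous c f) (@pos_ge0 c f).

Let slice_continuous (k : nat) f :
  continuous (fun x => Num.min (Cplus_cut k%:R f x) 1).
Proof.
move=> x; apply: (@continuous_min R X (Cplus_cut k%:R f) (fun=> 1)); last exact: cvg_cst.
exact: Cplus_continuous.
Qed.

Let slice_ge0 (k : nat) f x : 0 <= Num.min (Cplus_cut k%:R f x) 1.
Proof. by rewrite le_min Cplus_ge0 ler01. Qed.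

(** The layer of f between the heights k and k + 1.  Layers add up to f, and each
    of them lies between the indicators of two open superlevel sets of f: this
    is what links f to a content on open sets, and what builds partitions of
    unity out of f. *)
Definition slice (k : nat) f : Cplus X R :=
  MkCplus (@slice_continuous k f) (@slice_ge0 k f).

Lemma Cplus_ext f g : (forall x, f x = g x) -> f = g.
Proof.
case: f g => [f cf f0] [g cg g0] /= /funext fg.
by case: _ / fg in cg g0 *; rewrite (Prop_irrelevance cf cg) (Prop_irrelevance f0 g0).
Qed.

Lemma slice_sum f N x :
  \sum_(k < N) slice k f x = Num.min (f x) N%:R.
Proof.
elim: N => [|N IHN]; first by rewrite big_ord0; apply/esym/min_idPr/Cplus_ge0.
rewrite big_ord_recr /= IHN -natr1.
have /= fx0 := Cplus_ge0 f x; have N0 : 0 <= N%:R :> R by [].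
rewrite /Num.max; case: ifPn; rewrite -?leNgt => ?;
  by rewrite /Num.min; do ![case: ifPn; rewrite -?leNgt => ?]; lra.
Qed.

Lemma slice_anti f k x : slice k.+1 f x <= slice k f x.
Proof.
rewrite /= -natr1.
rewrite /Num.max; case: ifPn; rewrite -?leNgt => ?;
  by rewrite /Num.min; do ![case: ifPn; rewrite -?leNgt => ?]; lra.
Qed.

Lemma slice_le1 f k x : slice k f x <= 1.
Proof. by rewrite /= ge_min lexx orbT. Qed.

Lemma slice_ge1 f k x : k.+1%:R <= f x -> slice k f x = 1.
Proof.
rewrite /= -natr1.
rewrite /Num.max; case: ifPn; rewrite -?leNgt => ?;
  by rewrite /Num.min; do ![case: ifPn; rewrite -?leNgt => ?]; lra.
Qed.

Lemma slice_le0 f k x : f x <= k%:R -> slice k f x = 0.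
Proof.
rewrite /=.
rewrite /Num.max; case: ifPn; rewrite -?leNgt => ?;
  by rewrite /Num.min; do ![case: ifPn; rewrite -?leNgt => ?]; lra.
Qed.

Lemma Cplus_bounded f : compact [set: X] -> exists N, forall x, f x <= N%:R.
Proof.
move=> compactX; case: (pselect (exists x : X, True)) => [[x0 _]|X0]; last first.
  by exists 0%N => x; case: X0; exists x.
have [c _ fc] : exists2 c, c \in [set: X] & forall t, t \in [set: X] -> f t <= f c.
  apply: compact_EVT_max => //; first by exists x0.
  by apply: continuous_subspaceT; exact: Cplus_continuous.
exists (Num.truncn (f c)).+1 => x; apply: le_trans (fc x (mem_set I)) _.
exact/ltW/truncnS_gt.
Qed.

End Cplus_operations.

(** * Positive additive functionals *)

Definition positive_additive (X : topologicalType) (R : realType)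
    (L : Cplus X R -> R) : Prop :=
  (forall f, 0 <= L f) /\ (forall f g, L (Cplus_add f g) = L f + L g).

Lemma archimedean_eq0 (R : realType) (a C : R) :
  (forall n : nat, n%:R * `|a| <= C) -> a = 0.
Proof.
move=> aC; apply/eqP/contraT => a0.
have a_gt0 : 0 < `|a| by rewrite normr_gt0.
have := aC (Num.truncn (C / `|a|)).+1.
by rewrite leNgt -ltr_pdivrMr // truncnS_gt.
Qed.

Lemma le_add_eps_mul (R : realType) (a b C : R) :
  (forall e, 0 < e -> a <= b + e * C) -> a <= b.
Proof.
move=> H; apply/ler_addgt0Pr => e e0.
have C1 : 0 < `|C| + 1 by rewrite ltr_wpDl.
apply: (le_trans (H (e / (`|C| + 1)) _)); first by rewrite divr_gt0.
rewrite lerD2l mulrAC ler_pdivrMr // ler_pM2l //.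
by rewrite (le_trans (ler_norm C)) // lerDl.
Qed.

Section positive_additive_theory.
Variables (X : topologicalType) (R : realType) (L : Cplus X R -> R).
Hypothesis L_pa : positive_additive L.
Implicit Types f g h : Cplus X R.

Lemma pa_ge0 f : 0 <= L f. Proof. by case: L_pa. Qed.

Lemma pa_add f g h : (forall x, h x = f x + g x) -> L h = L f + L g.
Proof. by move=> hfg; case: L_pa => _ <-; congr L; exact: Cplus_ext. Qed.

Lemma pa_le f g : (forall x, f x <= g x) -> L f <= L g.
Proof.
move=> fg; rewrite (@pa_add f (Cplus_sub fg) g) ?lerDl ?pa_ge0 //.
by move=> x /=; rewrite addrC subrK.
Qed.

Lemma pa_eq0 f : (forall x, f x = 0) -> L f = 0.
Proof.
move=> f0; have : L f = L f + L f by apply: pa_add => x; rewrite f0 addr0.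
by move/eqP; rewrite -subr_eq0 opprD addrA subrr sub0r oppr_eq0 => /eqP.
Qed.

Lemma pa_sum (I : finType) (f : I -> Cplus X R) h :
  (forall x, h x = \sum_i f i x) -> L h = \sum_i L (f i).
Proof.
have gen (s : seq I) (h' : Cplus X R) : (forall x, h' x = \sum_(i <- s) f i x) ->
    L h' = \sum_(i <- s) L (f i).
  elim: s h' => [|i s IHs] h' h'E.
    by rewrite big_nil; apply: pa_eq0 => x; rewrite h'E big_nil.
  have tail_le x : f i x <= h' x.
    rewrite h'E big_cons lerDl; apply: sumr_ge0 => j _; exact: Cplus_ge0.
  rewrite big_cons (@pa_add (f i) (Cplus_sub tail_le) h').
    by congr (_ + _); apply: IHs => x /=; rewrite h'E big_cons addrC addKr.
  by move=> x /=; rewrite addrC subrK.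
exact: gen.
Qed.

Lemma pa_natM n f g : (forall x, g x = n%:R * f x) -> L g = n%:R * L f.
Proof.
move=> gf; rewrite (@pa_sum 'I_n (fun=> f) g).
  by rewrite sumr_const card_ord mulr_natl.
by move=> x; rewrite gf sumr_const card_ord mulr_natl.
Qed.

(** Additivity only gives natural multiples; for m <= n c < m + 1, monotonicity
    squeezes n L(c f) between m L f and (m + 1) L f, and n is arbitrary. *)
Lemma pa_scale (c : R) f g : 0 <= c -> (forall x, g x = c * f x) -> L g = c * L f.
Proof.
move=> c0 gf; apply/eqP; rewrite -subr_eq0; apply/eqP.
apply: (@archimedean_eq0 _ _ (L f)) => n.
have natM (k : nat) (h : Cplus X R) :
    L (Cplus_mul (Cplus_cst X (ler0n R k)) h) = k%:R * L h by exact: pa_natM.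
have /andP[mle ltm] := truncn_itv (mulr_ge0 (ler0n R n) c0).
set m := Num.truncn _ in mle ltm.
have lo : m%:R * L f <= n%:R * L g.
  rewrite -!natM; apply: pa_le => x /=; rewrite gf mulrA.
  by rewrite ler_wpM2r // Cplus_ge0.
have up : n%:R * L g <= m.+1%:R * L f.
  rewrite -!natM; apply: pa_le => x /=; rewrite gf mulrA.
  by rewrite ler_wpM2r ?Cplus_ge0 // ltW.
have Lf0 := pa_ge0 f.
rewrite -[n%:R]ger0_norm // -normrM mulrBr mulrA ler_norml.
have lo' := ler_wpM2r Lf0 mle; have up' := ler_wpM2r Lf0 (ltW ltm).
rewrite -natr1 mulrDl mul1r in up up'.
by apply/andP; split; lra.
Qed.

End positive_additive_theory.

(** * Partitions of unity and positivity on tensors *)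

Section partition_of_unity.
Variables (X : topologicalType) (R : realType).
Implicit Types f g h : Cplus X R.

(** The piecewise linear tent over [k - 1, k + 1] with apex 1 at k, composed with
    f.  As differences of consecutive layers, tents telescope. *)
Definition hat (k : nat) f : Cplus X R :=
  if k is k'.+1 then Cplus_sub (slice_anti f k')
  else @Cplus_sub X R (Cplus_cst X ler01) (slice 0 f) (slice_le1 f 0).

Lemma hat0E f x : hat 0 f x = 1 - slice 0 f x. Proof. by []. Qed.

Lemma hatSE f k x : hat k.+1 f x = slice k f x - slice k.+1 f x.
Proof. by []. Qed.

Lemma hat_sum f N x : \sum_(k < N.+1) hat k f x = 1 - slice N f x.
Proof.
elim: N => [|N IHN]; first by rewrite big_ord1.
rewrite big_ord_recr IHN hatSE; exact: subrKA.
Qed.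

Lemma hat_supp f k x : 0 < hat k f x -> k%:R - 1 <= f x <= k%:R + 1.
Proof.
move=> hat_gt0; apply/andP; split; rewrite leNgt; apply: contraTN hat_gt0 => lt_fx.
  case: k lt_fx => [|k] lt_fx.
    by have := Cplus_ge0 f x; rewrite leNgt (lt_trans lt_fx) // sub0r oppr_lt0.
  rewrite -natr1 addrK in lt_fx.
  by rewrite -leNgt hatSE !slice_le0 ?subrr // -?natr1; lra.
case: k lt_fx => [|k] lt_fx.
  by rewrite -leNgt hat0E slice_ge1 ?subrr //; lra.
rewrite -natr1 in lt_fx.
by rewrite -leNgt hatSE !slice_ge1 ?subrr // -?natr1 -?natr1; lra.
Qed.

Hypothesis compactX : compact [set: X].

(** The tents of a large multiple n f: on the support of one of them, n f varies
    by at most 2. *)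
Lemma partition_of_unity1 (e : R) f : 0 < e ->
  exists (I : finType) (phi : I -> Cplus X R),
    (forall x, \sum_a phi a x = 1) /\
    (forall a x y, 0 < phi a x -> 0 < phi a y -> `|f x - f y| <= e).
Proof.
move=> e0; set n := (Num.truncn (2 / e)).+1.
have n_gt : 2 / e < n%:R by exact: truncnS_gt.
pose g := Cplus_mul (Cplus_cst X (ler0n R n)) f.
have [N gN] := Cplus_bounded g compactX.
exists 'I_N.+1, (fun k : 'I_N.+1 => hat k g); split=> [x|k x y /hat_supp gx /hat_supp gy].
  by rewrite hat_sum slice_le0 ?subr0.
have : `|g x - g y| <= 2 by rewrite ler_distl; apply/andP; split; lra.
rewrite /= -mulrBr normrM ger0_norm // => le2.
rewrite ltr_pdivrMr // in n_gt.
have : n%:R * `|f x - f y| <= n%:R * e by exact: le_trans le2 (ltW n_gt).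
by rewrite ler_pM2l // ltr0n.
Qed.

(** Products of the partitions of the individual functions refine all of them. *)
Lemma partition_of_unity (e : R) (K : finType) (f : K -> Cplus X R) : 0 < e ->
  exists (I : finType) (phi : I -> Cplus X R),
    (forall x, \sum_a phi a x = 1) /\
    (forall k a x y, 0 < phi a x -> 0 < phi a y -> `|f k x - f k y| <= e).
Proof.
move=> e0.
suff gen (s : seq K) : exists (I : finType) (phi : I -> Cplus X R),
    (forall x, \sum_a phi a x = 1) /\
    (forall k a x y, k \in s -> 0 < phi a x -> 0 < phi a y ->
      `|f k x - f k y| <= e).
  have [I [phi [phi1 osc]]] := gen (enum K); exists I, phi; split => // k a x y.
  by apply: osc; rewrite mem_enum.
elim: s => [|k s [I [phi [phi1 osc]]]].
  exists unit, (fun=> Cplus_cst X ler01); split => [x|//].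
  by rewrite sumr_const card_unit.
have [J [psi [psi1 oscJ]]] := partition_of_unity1 (f k) e0.
exists (I * J)%type, (fun ab => Cplus_mul (phi ab.1) (psi ab.2)); split=> [x|].
  rewrite -(pair_bigA _ (fun a b => phi a x * psi b x)) /= -[RHS](phi1 x).
  by apply: eq_bigr => a _; rewrite -mulr_sumr psi1 mulr1.
move=> k' [a b] x y /=.
have pos z : 0 < phi a z * psi b z -> 0 < phi a z /\ 0 < psi b z.
  move=> ab0; rewrite !lt0r !Cplus_ge0 !andbT.
  by split; apply: contraTneq ab0 => ->; rewrite ?mul0r ?mulr0 ltxx.
rewrite inE => /orP[/eqP->|k's] /pos[ax bx] /pos[ay bY].
  exact: oscJ bx bY.
exact: osc k's ax ay.
Qed.

(** Let phi_a be a partition of unity.  On the support of phi_a, f_k differs by at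
    most e from its value at a point x_a of that support, so L_k (f_k phi_a) is
    f_k(x_a) L_k (phi_a) up to e L_k (phi_a).  By the hypothesis at x_a and
    h = phi_a, sum_k c_k L_k (f_k phi_a) is at least - e sum_k |c_k| L_k (phi_a);
    the sum over a gives the bound - e sum_k |c_k| L_k (1), for every e. *)
Lemma positive_combination (K : finType) (c : K -> R)
    (L : K -> Cplus X R -> R) (f : K -> Cplus X R) :
  (forall k, positive_additive (L k)) ->
  (forall x h, 0 <= \sum_k c k * f k x * L k h) ->
  0 <= \sum_k c k * L k (f k).
Proof.
move=> L_pa cfL_ge0; pose one := Cplus_cst X (@ler01 R).
apply: (@le_add_eps_mul _ _ _ (\sum_k `|c k| * L k one)) => e e0.
have [I [phi [phi1 osc]]] := partition_of_unity f e0.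
have Lf k : L k (f k) = \sum_a L k (Cplus_mul (f k) (phi a)).
  by apply: pa_sum => // x; rewrite /= -mulr_sumr phi1 mulr1.
have L1 k : L k one = \sum_a L k (phi a).
  by apply: pa_sum => // x; rewrite phi1.
under eq_bigr do rewrite Lf mulr_sumr.
under [X in _ + _ * X]eq_bigr do rewrite L1 mulr_sumr.
rewrite exchange_big [X in _ + _ * X]exchange_big mulr_sumr -big_split /=.
apply: sumr_ge0 => a _; rewrite mulr_sumr -big_split /=.
have [[x phix]|phi0] := pselect (exists x, 0 < phi a x); last first.
  have {}phi0 x : phi a x = 0.
    apply/eqP; rewrite eq_le Cplus_ge0 andbT leNgt; apply/negP => ?.
    by apply: phi0; exists x.
  rewrite big1 // => k _; rewrite !pa_eq0 ?mulr0 ?addr0 // => x.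
  by rewrite /= phi0 mulr0.
apply: le_trans (cfL_ge0 x (phi a)) _; apply: ler_sum => k _.
have oscM y : `|f k x - f k y| * phi a y <= e * phi a y.
  have := Cplus_ge0 (phi a) y; rewrite le_eqVlt => /orP[/eqP<-|phiy].
    by rewrite !mulr0.
  by rewrite ler_wpM2r ?Cplus_ge0 // (osc k a).
have scl (b : R) (b0 : 0 <= b) :
    L k (Cplus_mul (Cplus_cst X b0) (phi a)) = b * L k (phi a).
  exact: pa_scale.
have up : L k (Cplus_mul (f k) (phi a)) <= (f k x + e) * L k (phi a).
  rewrite -(scl _ (addr_ge0 (Cplus_ge0 (f k) x) (ltW e0))); apply: pa_le => // y.
  rewrite /= mulrDl; have := oscM y; have := Cplus_ge0 (phi a) y.
  have := ler_norm (f k y - f k x); rewrite distrC => H1 H2.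
  have := ler_wpM2r H2 H1; lra.
have lo : f k x * L k (phi a) <= L k (Cplus_mul (f k) (phi a)) + e * L k (phi a).
  rewrite -(scl _ (Cplus_ge0 (f k) x)) -(scl _ (ltW e0)).
  have <- : L k (Cplus_add (Cplus_mul (f k) (phi a))
      (Cplus_mul (Cplus_cst X (ltW e0)) (phi a))) = L k (Cplus_mul (f k) (phi a))
      + L k (Cplus_mul (Cplus_cst X (ltW e0)) (phi a)) by exact: (L_pa k).2.
  apply: pa_le => // y /=; have := oscM y; have := Cplus_ge0 (phi a) y.
  have := ler_norm (f k x - f k y) => H1 H2.
  have := ler_wpM2r H2 H1; lra.
have : `|f k x * L k (phi a) - L k (Cplus_mul (f k) (phi a))| <= e * L k (phi a).
  by rewrite ler_distl; apply/andP; split; lra.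
move=> /(ler_wpM2l (normr_ge0 (c k))); rewrite -normrM.
have := ler_norm (c k * (f k x * L k (phi a) - L k (Cplus_mul (f k) (phi a)))).
lra.
Qed.

End partition_of_unity.

Section multiadditive_positivity.
Variables (X : topologicalType) (R : realType) (n : nat).
Variable F : ('I_n -> Cplus X R) -> R.
Hypothesis compactX : compact [set: X].
Hypothesis F_ge0 : forall f, 0 <= F f.
Hypothesis F_additive : multiadditive F.

(** The weight w collects the values at the coordinates where points have not yet
    been replaced by functions. *)
Lemma multiadditive_slot (i : 'I_n) (t : 'I_n -> Cplus X R) (w : R) :
  0 <= w -> positive_additive (fun u => w * F (dfwith t i u)).
Proof.
move=> w0; split=> [u|u v]; first by rewrite mulr_ge0.
have dfw2 (u' v' : Cplus X R) : dfwith (dfwith t i u') i v' = dfwith t i v'.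
  apply/funext => j; have [->|ij] := eqVneq i j; first by rewrite !dfwithin.
  by rewrite !dfwithout.
have := F_additive i (dfwith t i u) v.
by rewrite dfwithin !dfw2 -mulrDr => ->.
Qed.

(** Downward induction on j for the claim that, at all points x and tuples h,
    sum_k c_k (prod_(i < j) f_ki(x_i)) F (h_0, ..., h_(j-1), f_kj, ..., f_k(n-1))
    is nonnegative.  For j = n the sum is the given combination times F h; the
    step trades the point x_j for the slot j of F by [positive_combination]. *)
Lemma multiadditive_positivity (K : finType) (c : K -> R)
    (f : K -> 'I_n -> Cplus X R) (p : 'I_n -> X) :
  (forall x : 'I_n -> X, 0 <= \sum_k c k * \prod_i f k i (x i)) ->
  0 <= \sum_k c k * F (f k).
Proof.
move=> cf_ge0.
pose mix j (h : 'I_n -> Cplus X R) k (i : 'I_n) := if (i < j)%N then h i else f k i.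
suff gen d j (x : 'I_n -> X) (h : 'I_n -> Cplus X R) : (j + d = n)%N ->
    0 <= \sum_k c k * \prod_(i < n | (i < j)%N) f k i (x i) * F (mix j h k).
  have := gen n 0%N p (fun=> Cplus_cst X ler01) (add0n n).
  congr (0 <= _); apply: eq_bigr => k _; rewrite big_pred0_eq mulr1; congr (_ * F _).
elim: d j x h => [|d IHd] j x h.
  rewrite addn0 => ->.
  have -> : \sum_k c k * \prod_(i < n | (i < n)%N) f k i (x i) * F (mix n h k)
     = (\sum_k c k * \prod_i f k i (x i)) * F h.
    rewrite mulr_suml; apply: eq_bigr => k _; congr (_ * _ * F _).
      by apply: eq_bigl => i; rewrite ltn_ord.
    by apply/funext => i; rewrite /mix ltn_ord.
  exact: mulr_ge0.
move=> jdn; have jn : (j < n)%N by rewrite -jdn addnS ltnS leq_addr.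
pose jo := Ordinal jn.
pose w k := \prod_(i < n | (i < j)%N) f k i (x i).
have w0 k : 0 <= w k by apply: prodr_ge0 => i _; exact: Cplus_ge0.
pose L k u := w k * F (dfwith (mix j h k) jo u).
have mixE k : dfwith (mix j h k) jo (f k jo) = mix j h k.
  apply/funext => i; have [<-|ij] := eqVneq jo i; last by rewrite dfwithout.
  by rewrite dfwithin /mix /= ltnn.
have -> : \sum_k c k * w k * F (mix j h k) = \sum_k c k * L k (f k jo).
  by apply: eq_bigr => k _; rewrite /L mixE mulrA.
apply: positive_combination => // [k|y u]; first exact: multiadditive_slot.
pose x' := dfwith x jo y : 'I_n -> X; pose h' := dfwith h jo u : 'I_n -> Cplus X R.
have := IHd j.+1 x' h'; rewrite addSnnS => /(_ jdn).
congr (0 <= _); apply: eq_bigr => k _.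
rewrite (bigD1 jo) //= /x' dfwithin /L -!mulrA; congr (_ * (_ * _)).
congr (_ * F _).
  rewrite /w; apply: eq_big => [i|i /andP[_ ij]]; last by rewrite dfwithout // eq_sym.
  by rewrite ltnS ltn_neqAle andbC.
apply/funext => i; rewrite /mix ltnS /h'.
have [<-|ij] := eqVneq jo i; first by rewrite !dfwithin leqnn.
rewrite !dfwithout //; rewrite [(i <= j)%N]leq_eqVlt (_ : (i == j :> nat) = false) //.
by apply/negbTE; rewrite eq_sym; exact: ij.
Qed.

End multiadditive_positivity.

(** * Density of tensors and extension of the functional *)

Section separation.
Variables (X : topologicalType) (R : realType).
Hypothesis compactX : compact [set: X].
Hypothesis hausdorffX : hausdorff_space X.

Lemma Cplus_urysohn (A B : set X) :
  closed A -> closed B -> A `&` B = set0 ->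
  exists u : Cplus X R, [/\ forall x, u x <= 1, forall x, A x -> u x = 0
    & forall x, B x -> u x = 1].
Proof.
move=> cA cB AB.
have sep := (@normal_separatorP R X).1 (compact_normal hausdorffX compactX) _ _ cA cB AB.
have [u [cu u01 uA uB]] := (@uniform_separatorP X R A B).1 sep.
have ran x : 0 <= u x <= 1 by have := u01 (u x); rewrite /= in_itv; apply; exists x.
have u0 x : 0 <= u x by case/andP: (ran x).
exists (MkCplus cu u0); split=> [x|x Ax|x Bx] /=; first by case/andP: (ran x).
  by apply: uA; exists x.
by apply: uB; exists x.
Qed.

End separation.

Section tensors.
Variables (X : topologicalType) (R : realType) (n : nat).
Hypothesis compactX : compact [set: X].
Hypothesis hausdorffX : hausdorff_space X.
Local Notation Y := {ptws 'I_n -> X}.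

Lemma power_compact : compact [set: Y].
Proof.
have := @tychonoff 'I_n (fun=> X) (fun=> [set: X]) (fun=> compactX).
by congr (compact _); apply/seteqP; split.
Qed.

Lemma power_hausdorff : hausdorff_space Y.
Proof. exact: (@hausdorff_product 'I_n (fun=> X)). Qed.

Lemma coordinate_continuous i : continuous (fun y : Y => y i).
Proof. exact: (@proj_continuous 'I_n (fun=> X) i). Qed.

Let coord_continuous (f : Cplus X R) i : continuous (fun y : Y => f (y i)).
Proof.
move=> y; apply: (@continuous_comp _ _ _ (fun y : Y => y i) f).
  exact: coordinate_continuous.
exact: Cplus_continuous.
Qed.

Let tensor_continuous (f : 'I_n -> Cplus X R) :
  continuous (fun y : Y => \prod_i f i (y i)).
Proof.
apply: (@continuous_big R 'I_n *%R 1 xpredT _ Y (index_enum 'I_n)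
  (fun i (y : Y) => f i (y i))) => [|i _]; last exact: coord_continuous.
exact: mul_continuous.
Qed.

Let tensor_ge0 (f : 'I_n -> Cplus X R) (y : Y) : 0 <= \prod_i f i (y i).
Proof. by apply: prodr_ge0 => i _; exact: Cplus_ge0. Qed.

Definition tensor (f : 'I_n -> Cplus X R) : Cplus Y R :=
  MkCplus (@tensor_continuous f) (@tensor_ge0 f).

(** The pairs (y, z) at which g differs by at least e form a compact set.  It
    misses the diagonal, so it is covered by the open sets of pairs separated in
    some coordinate by some continuous function, and finitely many of them
    suffice. *)
Lemma finite_modulus (g : Cplus Y R) (e : R) : 0 < e -> Y ->
  exists (K : finType) (h : K -> Cplus X R), forall y z : Y,
    (forall k i, `|h k (y i) - h k (z i)| <= 1) -> `|g y - g z| <= e.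
Proof.
move=> e0 p; pose Z := pointed_at (p, p).
pose far : set Z := [set yz | e <= `|g yz.1 - g yz.2|].
have dist_continuous (u : Cplus Y R) : continuous (fun yz : Z => `|u yz.1 - u yz.2|).
  move=> yz; apply: cvg_norm; apply: cvgB.
    by apply: (@continuous_comp _ _ _ fst u); [exact: cvg_fst | exact: Cplus_continuous].
  by apply: (@continuous_comp _ _ _ snd u); [exact: cvg_snd | exact: Cplus_continuous].
have compactZ : compact [set: Z].
  have := compact_setX power_compact power_compact.
  by congr (compact _); apply/seteqP; split.
have compact_far : compact far.
  apply: subclosed_compact compactZ _ => //.
  rewrite (_ : far = (fun yz : Z => `|g yz.1 - g yz.2|) @^-1` [set r | e <= r]) //.
  by apply: preimage_closed => //; exact: closed_ge.
pose split_by (hi : {classic Cplus X R} * 'I_n) : set Z :=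
  [set yz | 1 < `|(hi.1 : Cplus X R) (yz.1 hi.2) - (hi.1 : Cplus X R) (yz.2 hi.2)|].
have := compact_far; rewrite compact_cover => /(_ _ setT split_by).
case=> [[h i] _|[y z] /= far_yz|D _ farD].
- rewrite (_ : split_by _ = (fun yz : Z => `|(h : Cplus X R) (yz.1 i)
      - (h : Cplus X R) (yz.2 i)|) @^-1` [set r | 1 < r]) //.
  apply: open_comp => [yz _|]; last exact: open_gt.
  exact: (dist_continuous (MkCplus (@coord_continuous h i) (fun y => Cplus_ge0 h (y i)))).
- have /existsNP[i yzi] : ~ forall i, y i = z i.
    move=> /funext yz; move: far_yz; rewrite /far /= yz subrr normr0.
    by rewrite leNgt e0.
  have [|||u [_ u0 u1]] := @Cplus_urysohn X R compactX hausdorffX [set y i] [set z i].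
  + exact/accessible_closed_set1/hausdorff_accessible.
  + exact/accessible_closed_set1/hausdorff_accessible.
  + by apply/seteqP; split=> // t [-> /yzi].
  (* Doubling the Urysohn function makes the gap between its values exceed 1. *)
  exists (Cplus_add u u, i) => //; rewrite /split_by /= u0 // u1 //.
  by rewrite addr0 sub0r normrN ger0_norm; lra.
exists D, (fun k => (val k).1); move=> y z close_yz.
rewrite leNgt; apply/negP => far_yz.
have [hi hiD] := farD (y, z) (ltW far_yz).
rewrite /split_by /= ltNge => /negP; apply.
exact: (close_yz [` hiD]%fset hi.2).
Qed.

(** For a partition of unity of X that is fine for the functions of
    [finite_modulus], the products phi_(a 1) (x) ... (x) phi_(a n) are a partition
    of unity of X^n, and g is within e of a constant c_a on the support of each
    of them. *)
Lemma tensor_approximation (g : Cplus Y R) (e : R) : 0 < e -> Y ->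
  exists (K : finType) (c : K -> R) (f : K -> 'I_n -> Cplus X R),
    forall y : Y, `|g y - \sum_k c k * tensor (f k) y| <= e.
Proof.
move=> e0 p; have [K [h modulus]] := finite_modulus g e0 p.
have [I [phi [phi1 osc]]] := partition_of_unity compactX h (@ltr01 R).
pose box (a : {ffun 'I_n -> I}) : set Y := [set y | forall i, 0 < phi (a i) (y i)].
have /choice[c cP] a : exists c : R, forall y, box a y -> `|g y - c| <= e.
  have [[z az]|noz] := pselect (exists z, box a z).
    by exists (g z) => y ay; apply: modulus => k i; exact: osc.
  by exists 0 => y ay; case: noz; exists y.
exists {ffun 'I_n -> I}, c, (fun (a : {ffun 'I_n -> I}) i => phi (a i)) => y.
have tensor1 : \sum_(a : {ffun 'I_n -> I}) tensor (fun i => phi (a i)) y = 1.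
  by rewrite -(bigA_distr_bigA (fun i b => phi b (y i))) big1.
rewrite -[g y]mulr1 -tensor1 mulr_sumr -sumrB -[leRHS]mulr1 -tensor1 mulr_sumr.
apply: (le_trans (ler_norm_sum _ _ _)); apply: ler_sum => a _.
rewrite -mulrBl normrM [ `|tensor _ _|]ger0_norm ?Cplus_ge0 //.
have [ay|nay] := pselect (box a y).
  by rewrite ler_wpM2r ?Cplus_ge0 // cP.
have /existsNP[i /negP] := nay.
rewrite -leNgt => phi_le0.
have phi0 : phi (a i) (y i) = 0 by apply/eqP; rewrite eq_le phi_le0 Cplus_ge0.
by rewrite /tensor /= (bigD1 i) //= phi0 mul0r !mulr0.
Qed.

Section extension.
Variable F : ('I_n -> Cplus X R) -> R.
Hypothesis F_ge0 : forall f, 0 <= F f.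
Hypothesis F_additive : multiadditive F.
Variable p : Y.

(** Every combination of tensors above g bounds the value sought from above; the
    extension takes the least such bound, as in the Hahn-Banach theorem, and the
    density of tensors makes it additive. *)
Definition majorant_values (g : Cplus Y R) : set R :=
  [set v | exists (K : finType) (c : K -> R) (f : K -> 'I_n -> Cplus X R),
    (forall y, g y <= \sum_k c k * tensor (f k) y) /\ v = \sum_k c k * F (f k)].

Definition tensor_extension (g : Cplus Y R) : R := inf (majorant_values g).

Let one : 'I_n -> Cplus X R := fun=> Cplus_cst X ler01.

Let tensor_one y : tensor one y = 1.
Proof. by rewrite /tensor /= big1. Qed.

Let sum_unit (G : unit -> R) : \sum_k G k = G tt.
Proof. by rewrite (big_pred1 tt) // => -[]. Qed.

(** Positivity of F on tensors, applied to a difference of combinations. *)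
Lemma combination_le (K J : finType) (c : K -> R) (d : J -> R)
    (f : K -> 'I_n -> Cplus X R) (g : J -> 'I_n -> Cplus X R) :
  (forall y : Y, \sum_k c k * tensor (f k) y <= \sum_j d j * tensor (g j) y) ->
  \sum_k c k * F (f k) <= \sum_j d j * F (g j).
Proof.
move=> le_cd; rewrite -subr_ge0.
pose b (kj : K + J) := match kj with inl k => - c k | inr j => d j end.
pose t (kj : K + J) := match kj with inl k => f k | inr j => g j end.
have := @multiadditive_positivity X R n F compactX F_ge0 F_additive
  (K + J)%type b t p.
rewrite big_sumType /=.
under eq_bigr do rewrite mulNr.
rewrite sumrN addrC; apply=> x.
have := le_cd x; rewrite -subr_ge0 big_sumType /= addrC.
congr (0 <= _); congr (_ + _).
by rewrite -sumrN; apply: eq_bigr => k _; rewrite mulNr.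
Qed.

Lemma majorant_values_ge0 g v : majorant_values g v -> 0 <= v.
Proof.
case=> K [c [f [gle ->]]].
have := @combination_le void K (fun=> 0) c (fun _ => one) f.
rewrite big1 => [|k _]; last by rewrite mul0r.
by apply=> y; rewrite big1 => [|k _]; rewrite ?mul0r ?(le_trans (Cplus_ge0 g y)).
Qed.

Lemma majorant_values_inf g : has_inf (majorant_values g).
Proof.
split; last by exists 0 => v; exact: majorant_values_ge0.
have [N gN] := Cplus_bounded g power_compact.
exists (\sum_(k : unit) N%:R * F one); exists unit, (fun=> N%:R), (fun=> one).
by split => // y; rewrite sum_unit tensor_one mulr1.
Qed.

Lemma tensor_extension_le g v : majorant_values g v -> tensor_extension g <= v.
Proof. by move=> gv; apply: ge_inf => //; have [] := majorant_values_inf g. Qed.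

Lemma le_tensor_extension g r :
  (forall v, majorant_values g v -> r <= v) -> r <= tensor_extension g.
Proof. by move=> ler; apply: lb_le_inf => //; have [] := majorant_values_inf g. Qed.

Lemma majorant_add f g v w : majorant_values f v -> majorant_values g w ->
  majorant_values (Cplus_add f g) (v + w).
Proof.
case=> K [c [s [fle ->]]] [J [d [t [gle ->]]]].
exists (K + J)%type, (fun kj => match kj with inl k => c k | inr j => d j end),
  (fun kj => match kj with inl k => s k | inr j => t j end).
split=> [y|]; rewrite big_sumType //=.
by apply: lerD; [exact: fle | exact: gle].
Qed.

(** Raising an e/2-approximation of g by the constant e/2, itself a multiple of
    the tensor 1 (x) ... (x) 1, puts it above g. *)
Lemma tight_majorant (g : Cplus Y R) (e : R) : 0 < e ->
  exists (K : finType) (c : K -> R) (f : K -> 'I_n -> Cplus X R),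
    forall y, g y <= \sum_k c k * tensor (f k) y <= g y + e.
Proof.
move=> e0; have e2 : 0 < e / 2 by rewrite divr_gt0.
have [K [c [f appr]]] := tensor_approximation g e2 p.
exists (K + unit)%type,
  (fun k => match k with inl k => c k | inr _ => e / 2 end),
  (fun k => match k with inl k => f k | inr _ => one end) => y.
rewrite big_sumType sum_unit tensor_one mulr1 /=.
by have /= := appr y; rewrite ler_distl => /andP[]; lra.
Qed.

(** An infimum of this kind is subadditive by construction.  Conversely, if s and
    t are within e of f and g from above, then any majorant of f + g is at least
    s + t - 2 e, so that its value is at least those of s and t together, up to
    2 e F (1, ..., 1). *)
Lemma tensor_extension_pa : positive_additive tensor_extension.
Proof.
split=> [g|f g].
  by apply: le_tensor_extension => v; exact: majorant_values_ge0.
apply/eqP; rewrite eq_le; apply/andP; split.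
  rewrite -lerBlDr; apply: le_tensor_extension => v fv.
  rewrite lerBlDr addrC -lerBlDr; apply: le_tensor_extension => w gw.
  by rewrite lerBlDr addrC; apply/tensor_extension_le/majorant_add.
apply: le_tensor_extension => _ [J [d [t [fgle ->]]]].
apply: (@le_add_eps_mul _ _ _ (2 * F one)) => e e0.
have [K1 [c1 [s1 H1]]] := tight_majorant f e0.
have [K2 [c2 [s2 H2]]] := tight_majorant g e0.
have le1 : tensor_extension f <= \sum_k c1 k * F (s1 k).
  by apply: tensor_extension_le; exists K1, c1, s1; split => // y; case/andP: (H1 y).
have le2 : tensor_extension g <= \sum_k c2 k * F (s2 k).
  by apply: tensor_extension_le; exists K2, c2, s2; split => // y; case/andP: (H2 y).
apply: le_trans (lerD le1 le2) _.
have := @combination_le (K1 + K2)%type (J + unit)%type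
  (fun k => match k with inl k => c1 k | inr k => c2 k end)
  (fun k => match k with inl k => d k | inr _ => e * 2 end)
  (fun k => match k with inl k => s1 k | inr k => s2 k end)
  (fun k => match k with inl k => t k | inr _ => one end).
rewrite !big_sumType /= !sum_unit mulrA; apply=> y.
rewrite !big_sumType !sum_unit /= big1_eq mulr1.
have /= /andP[_ u1] := H1 y; have /= /andP[_ u2] := H2 y; have /= := fgle y.
lra.
Qed.

Lemma tensor_extensionE f : tensor_extension (tensor f) = F f.
Proof.
have FE : F f = \sum_(k : unit) 1 * F f.
  by rewrite sum_unit mul1r.
have tE y : tensor f y = \sum_(k : unit) 1 * tensor f y.
  by rewrite sum_unit mul1r.
apply/eqP; rewrite eq_le; apply/andP; split.
  apply: tensor_extension_le; exists unit, (fun=> 1), (fun=> f); split => // y.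
  by rewrite -tE.
apply: le_tensor_extension => _ [J [d [t [fle ->]]]].
by rewrite FE; apply: combination_le => y; rewrite -tE.
Qed.

End extension.
End tensors.

(** * Functionals squeezed by a set function on open sets *)

Section comparison.
Variables (X : topologicalType) (R : realType).

Definition under (V : set X) (f : Cplus X R) : Prop :=
  (forall x, f x <= 1) /\ (forall x, ~ V x -> f x = 0).

Definition over (V : set X) (f : Cplus X R) : Prop := forall x, V x -> 1 <= f x.

Lemma under_sub (V W : set X) f : V `<=` W -> under V f -> under W f.
Proof. by move=> VW [f1 f0]; split=> // x Wx; apply: f0 => /VW. Qed.

Lemma open_superlevel (f : Cplus X R) (r : R) : open [set x | r < f x].
Proof.
rewrite (_ : [set x | _] = f @^-1` [set t | r < t]) //.
by apply: open_comp => [x _|]; [exact: Cplus_continuous | exact: open_gt].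
Qed.

Lemma closed_superlevel (f : Cplus X R) (r : R) : closed [set x | r <= f x].
Proof.
rewrite (_ : [set x | _] = f @^-1` [set t | r <= t]) //.
by apply: closed_comp => [x _|]; [exact: Cplus_continuous | exact: closed_ge].
Qed.

Definition sandwiches (m : set X -> R) (L : Cplus X R -> R) : Prop :=
  forall V f, open V ->
    (under V f -> L f <= m V) /\ (over V f -> m V <= L f).

(** Let V_k be the set where f > k.  The k-th layer of f has a value between
    m V_(k+1) and m V_k under both functionals, so their values at f differ by at
    most the telescoping sum of m V_k - m V_(k+1), hence by at most L 1.  This
    bound does not depend on f: applied to n f for all n, it forces equality. *)
Lemma sandwich_unique (m : set X -> R) (L M : Cplus X R -> R) :
  compact [set: X] -> positive_additive L -> positive_additive M ->
  sandwiches m L -> sandwiches m M -> L =1 M.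
Proof.
move=> compactX L_pa M_pa mL mM f.
pose one := Cplus_cst X (@ler01 R).
have gap (g : Cplus X R) : `|L g - M g| <= L one.
  have [N gN] := Cplus_bounded g compactX.
  pose V (k : nat) := [set x | k%:R < g x].
  have bounds (P : Cplus X R -> R) : positive_additive P -> sandwiches m P ->
      \sum_(k < N) m (V k.+1) <= P g <= \sum_(k < N) m (V k).
    move=> P_pa mP; rewrite (@pa_sum X R P P_pa 'I_N (fun k => slice k g) g); last first.
      by move=> x; rewrite slice_sum; apply/esym/min_idPl.
    apply/andP; split; apply: ler_sum => k _.
      have [_] := mP (V k.+1) (slice k g) (open_superlevel g _); apply=> x Vx.
      by rewrite slice_ge1 // ltW.
    have [] := mP (V k) (slice k g) (open_superlevel g _); move=> + _; apply.
    split=> x; first exact: slice_le1.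
    by move/negP; rewrite -leNgt; exact: slice_le0.
  have /andP[L1 L2] := bounds L L_pa mL; have /andP[M1 M2] := bounds M M_pa mM.
  have tele : \sum_(k < N) m (V k) - \sum_(k < N) m (V k.+1) = m (V 0%N) - m (V N).
    rewrite -sumrB -(big_mkord xpredT (fun k => m (V k) - m (V k.+1))).
    rewrite -[RHS]opprB -(telescope_sumr (fun k => m (V k)) (leq0n N)) -sumrN.
    by apply: eq_bigr => k _; rewrite opprB.
  have V0 : m (V 0%N) <= L one by apply: (mL _ one (open_superlevel g _)).2 => x _.
  have VN : 0 <= m (V N).
    rewrite -(@pa_eq0 X R L L_pa (Cplus_cst X (lexx (0 : R)))) //.
    by apply: (mL _ _ (open_superlevel g _)).1; split=> x //=.
  rewrite ler_distl; apply/andP; split; lra.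
apply/eqP; rewrite -subr_eq0; apply/eqP.
apply: (@archimedean_eq0 _ _ (L one)) => n.
have := gap (Cplus_mul (Cplus_cst X (ler0n R n)) f).
have natM P : positive_additive P ->
    P (Cplus_mul (Cplus_cst X (ler0n R n)) f) = n%:R * P f.
  by move=> P_pa; exact: pa_natM.
by rewrite !natM // -mulrBr normrM ger0_norm.
Qed.

End comparison.

(** * Riesz representation on a compact Hausdorff space *)

Section riesz.
Local Open Scope ereal_scope.
Variables (R : realType) (T : ptopologicalType) (L : Cplus T R -> R).
Hypothesis compactT : compact [set: T].
Hypothesis hausdorffT : hausdorff_space T.
Hypothesis L_pa : positive_additive L.

Let one := Cplus_cst T (@ler01 R).

Definition open_content (V : set T) : \bar R :=
  ereal_sup [set (L f)%:E | f in [set f | under V f]].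

Definition riesz_outer (A : set T) : \bar R :=
  ereal_inf [set open_content V | V in [set V | open V /\ A `<=` V]].

Lemma content_ge (V : set T) f : under V f -> (L f)%:E <= open_content V.
Proof. by move=> Vf; apply: ereal_sup_ubound; exists f. Qed.

Lemma content_le (V : set T) r :
  (forall f, under V f -> (L f)%:E <= r) -> open_content V <= r.
Proof. by move=> H; apply: ge_ereal_sup => _ [f Vf <-]; exact: H. Qed.

Lemma content_ge0 V : 0 <= open_content V.
Proof.
have zeroV : under V (Cplus_cst T (lexx (0 : R)%R)) by split=> x //=.
by have := content_ge zeroV; rewrite (@pa_eq0 _ _ _ L_pa).
Qed.

Lemma content_le_over V f : over V f -> open_content V <= (L f)%:E.
Proof.
move=> Vf; apply: content_le => g [g1 g0]; rewrite lee_fin pa_le // => x.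
have [Vx|/g0->] := pselect (V x); last exact: Cplus_ge0.
exact: le_trans (g1 x) (Vf x Vx).
Qed.

Lemma content_fin_num V : open_content V \is a fin_num.
Proof.
rewrite ge0_fin_numE ?content_ge0 //.
by apply: (le_lt_trans (@content_le_over V one _)); rewrite ?ltry // => x _.
Qed.

Lemma content_mono V W : V `<=` W -> open_content V <= open_content W.
Proof. by move=> VW; apply: content_le => f /(under_sub VW); exact: content_ge. Qed.

Lemma content_set0 : open_content set0 = 0.
Proof.
apply/eqP; rewrite eq_le content_ge0 andbT; apply: content_le => f [_ f0].
by rewrite (@pa_eq0 _ _ _ L_pa) // => x; exact: f0.
Qed.

(** The cut (f - d)+ lives on the closed set where f >= d, which lies inside V,
    and cutting loses at most d L 1.  Working inside a closed, hence compact,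
    subset of V is what allows separation and finite subcovers below. *)
Lemma closed_support (V : set T) f (e : R) : under V f -> (0 < e)%R ->
  exists g K, [/\ closed K, K `<=` V, under K g & (L f <= L g + e)%R].
Proof.
move=> [f1 f0] e0; have L1 : (0 < L one + 1)%R by rewrite ltr_wpDl // pa_ge0.
pose d := (e / (L one + 1))%R; have d0 : (0 < d)%R by rewrite divr_gt0.
exists (Cplus_cut d f), [set x | (d <= f x)%R]; split.
- exact: closed_superlevel.
- by move=> x /= dfx; apply: contrapT => /f0 fx0; rewrite fx0 leNgt d0 in dfx.
- split=> x /=; first by rewrite ge_max ler01 andbT; have := f1 x; lra.
  by move/negP; rewrite -ltNge => fxd; apply/max_idPr; lra.
have -> : (e = d * (L one + 1))%R by rewrite mulrVK // unitfE gt_eqF.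
pose dc := Cplus_mul (Cplus_cst T (ltW d0)) one.
have dcE : L dc = (d * L one)%R by apply: (pa_scale L_pa) => //; exact: ltW.
have : (L f <= L (Cplus_add (Cplus_cut d f) dc))%R.
  apply: pa_le => // x /=; rewrite mulr1 -lerBlDr le_max lexx //.
rewrite (L_pa.2 _ _) dcE; lra.
Qed.

(** A function carried by a closed K inside V `|` W is cut in two by a Urysohn
    function that vanishes off V and equals 1 on K `\` W. *)
Lemma content_setU (V W : set T) : open V -> open W ->
  open_content (V `|` W) <= open_content V + open_content W.
Proof.
move=> oV oW; apply: content_le => f fVW; apply/lee_addgt0Pr => e e0.
have [g [K [cK KVW [g1 g0] fg]]] := closed_support fVW e0.
have [|||u [u1 u0 uK]] :=
    @Cplus_urysohn T R compactT hausdorffT (~` V) (K `&` ~` W).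
- exact: open_closedC.
- by apply: closedI => //; exact: open_closedC.
- by apply/seteqP; split=> // x [/= nVx [/KVW[]]].
have le_ug x : (Cplus_mul u g x <= g x)%R by rewrite /= ler_piMl ?Cplus_ge0.
have split_g : (L g = L (Cplus_mul u g) + L (Cplus_sub le_ug))%R.
  by apply: pa_add => // x /=; rewrite addrC subrK.
apply: (@le_trans _ _ (L g + e)%:E); first by rewrite lee_fin.
rewrite EFinD leeD2r // split_g EFinD; apply: leeD; apply: content_ge; split=> x /=.
- by rewrite mulr_ile1 ?Cplus_ge0.
- by move=> nVx; rewrite u0 // mul0r.
- have := g1 x; have := mulr_ge0 (Cplus_ge0 u x) (Cplus_ge0 g x); lra.
- move=> nWx; have [Kx|nKx] := pselect (K x); first by rewrite uK // mul1r subrr.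
  by rewrite g0 // mulr0 subrr.
Qed.

Lemma content_bigcup (V : (set T)^nat) : (forall i, open (V i)) ->
  open_content (\bigcup_i V i) <= \sum_(i <oo) open_content (V i).
Proof.
move=> oV; apply: content_le => f fV; apply/lee_addgt0Pr => e e0.
have [g [K [cK KV gK fg]]] := closed_support fV e0.
have compactK : compact K by apply: subclosed_compact compactT _.
have := compactK; rewrite compact_cover => /(_ _ setT V).
case=> [i _|x /KV[i _ Vix]|D _ KD]; [exact: oV | by exists i |].
pose N := (\max_(i : D) val i).+1.
have DN i : i \in D -> (i < N)%N.
  by move=> iD; rewrite ltnS (@leq_bigmax _ (fun i : D => val i) [` iD]%fset).
have le_fin_sum : open_content (\big[setU/set0]_(i < N) V i)
    <= \sum_(i < N) open_content (V i).
  elim: N {DN} => [|N IHN]; first by rewrite !big_ord0 content_set0.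
  rewrite !big_ord_recr /=; apply: le_trans (content_setU _ (oV N)) _.
    by rewrite -bigcup_mkord; exact: bigcup_open.
  exact: leeD2r.
apply: (@le_trans _ _ (L g + e)%:E); first by rewrite lee_fin.
rewrite EFinD leeD2r //; apply: (@le_trans _ _ (\sum_(i < N) open_content (V i))).
  apply: le_trans le_fin_sum; apply: content_ge; apply: under_sub gK => x /KD[i iD Vix].
  by rewrite -bigcup_mkord; exists i => //=; exact: DN.
rewrite -(big_mkord xpredT (fun i => open_content (V i))).
by apply: nneseries_lim_ge => i _ _; exact: content_ge0.
Qed.

Lemma outer_le_content A V : open V -> A `<=` V -> riesz_outer A <= open_content V.
Proof. by move=> oV AV; apply: ereal_inf_lbound; exists V. Qed.

Lemma outer_open V : open V -> riesz_outer V = open_content V.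
Proof.
move=> oV; apply/eqP; rewrite eq_le outer_le_content //=.
by apply: le_ereal_inf_tmp => _ [W [_ VW] <-]; exact: content_mono.
Qed.

Lemma outer_ge0 A : 0 <= riesz_outer A.
Proof. by apply: le_ereal_inf_tmp => _ [W _ <-]; exact: content_ge0. Qed.

Lemma outer_mono : {homo riesz_outer : A B / A `<=` B >-> A <= B}.
Proof.
move=> A B AB; apply: le_ereal_inf_tmp => _ [W [oW BW] <-].
by apply: outer_le_content => // x /AB/BW.
Qed.

Lemma outer_fin_num A : riesz_outer A \is a fin_num.
Proof.
rewrite ge0_fin_numE ?outer_ge0 //; apply: (@le_lt_trans _ _ (open_content setT)).
  by apply: outer_le_content => //; exact: openT.
by rewrite -ge0_fin_numE ?content_fin_num ?content_ge0.
Qed.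

Lemma outer_set0 : riesz_outer set0 = 0.
Proof. by rewrite outer_open ?content_set0 //; exact: open0. Qed.

Lemma outer_regular A (e : R) : (0 < e)%R ->
  exists V, [/\ open V, A `<=` V & open_content V <= riesz_outer A + e%:E].
Proof.
move=> e0; have [_ [V [oV AV] <-] /ltW] := lb_ereal_inf_adherent e0 (outer_fin_num A).
by exists V.
Qed.

Lemma outer_sigma_subadditive : sigma_subadditive riesz_outer.
Proof.
move=> A; apply/lee_addgt0Pr => e e0.
have e2 i : (0 < e / (2 ^ i.+1)%:R)%R by rewrite divr_gt0 // ltr0n expn_gt0.
have /choice[V VP] i := outer_regular (A i) (e2 i).
have oV i : open (V i) by have [] := VP i.
apply: (@le_trans _ _ (open_content (\bigcup_i V i))).
  apply: outer_le_content; first exact: bigcup_open.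
  by apply: subset_bigcup => i _; have [] := VP i.
apply: le_trans (content_bigcup oV) _.
apply: le_trans (epsilon_trick xpredT _ (ltW e0)); last by move=> i; exact: outer_ge0.
by apply: lee_nneseries => [i _ _|i _]; [exact: content_ge0 | have [] := VP i].
Qed.

Definition riesz_outer_measure : {outer_measure set T -> \bar R} :=
  HB.pack riesz_outer (isOuterMeasure.Build R T riesz_outer
    outer_set0 outer_ge0 outer_mono outer_sigma_subadditive).

(** Take V open around A.  A function carried by a closed K inside V `&` U leaves
    the open set V `\` K, which contains A `\` U, to other functions, and the sum
    of both kinds is still below the indicator of V. *)
Lemma open_caratheodory U : open U -> caratheodory_measurable riesz_outer U.
Proof.
move=> oU; apply: (@le_caratheodory_measurable R T riesz_outer_measure) => A.
change (riesz_outer (A `&` U) + riesz_outer (A `&` ~` U) <= riesz_outer A).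
apply: le_ereal_inf_tmp => _ [V [oV AV] <-].
apply: (@le_trans _ _ (open_content (V `&` U) + riesz_outer (A `&` ~` U))).
  by apply: leeD2r; apply: outer_le_content; [exact: openI | exact: setSI].
rewrite -leeBrDr ?outer_fin_num //; apply: content_le => f fVU.
rewrite leeBrDr ?outer_fin_num //; apply/lee_addgt0Pr => e e0.
have [g [K [cK KVU gK fg]]] := closed_support fVU e0.
have oVK : open (V `&` ~` K) by apply: openI => //; exact: closed_openC.
have : riesz_outer (A `&` ~` U) <= open_content (V `&` ~` K).
  apply: outer_le_content => // x [Ax nUx]; split; first exact: AV.
  by move=> /KVU[].
have : open_content (V `&` ~` K) <= open_content V - (L g)%:E.
  apply: content_le => h [h1 h0]; rewrite leeBrDr // -EFinD -L_pa.2.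
  have [g1 g0] := gK; apply: content_ge; split=> x /=.
    have [Kx|nKx] := pselect (K x); last by rewrite (g0 x) // addr0.
    by rewrite h0 ?add0r // => -[_ /(_ Kx)].
  move=> nVx; rewrite h0 ?g0 ?addr0 // => [/KVU[]//|[]//].
move=> /[swap] /le_trans /[apply].
rewrite leeBrDr // addeC => outer_le; apply: le_trans (leeD2r e%:E outer_le).
by rewrite addeAC -EFinD leeD2r // lee_fin.
Qed.

Lemma borel_caratheodory (A : set (borelType T)) :
  measurable A -> caratheodory_measurable riesz_outer A.
Proof.
move=> mA; pose mu := riesz_outer_measure.
have : <<s (@open T) >> `<=` caratheodory_measurable riesz_outer.
  apply: smallest_sub; last exact: open_caratheodory.
  exact: (@sigma_algebra_measurable _ (caratheodory_type mu)).
by apply.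
Qed.

Let mu0 (A : set (borelType T)) : \bar R := riesz_outer A.

Let mu0_sigma_additive : semi_sigma_additive mu0.
Proof.
move=> A mA tA mUA.
by apply: (@caratheodory_measure_sigma_additive R T riesz_outer_measure A) => //;
  [move=> i|]; exact: borel_caratheodory.
Qed.

Let mu0_fin : fin_num_fun mu0.
Proof. by move=> A _; exact: outer_fin_num. Qed.

Definition riesz_measure : {finite_measure set (borelType T) -> \bar R} :=
  let m := isMeasure.Build _ (borelType T) R mu0 outer_set0 outer_ge0
    mu0_sigma_additive in
  let mu1 : {measure set (borelType T) -> \bar R} := HB.pack mu0 m in
  HB.pack mu0 mu1 (Measure_isFinite.Build _ (borelType T) R mu1 mu0_fin).

Let mu := riesz_measure.

Let muE A : mu A = riesz_outer A. Proof. by []. Qed.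

Let measurable_open (U : set (borelType T)) : @open T U -> measurable U.
Proof. exact: sub_sigma_algebra. Qed.

(** Inner regularity on A is outer regularity on the complement of A, since the
    complement of an open set is compact and the measure is finite. *)
Lemma riesz_measure_radon : radon mu.
Proof.
split=> [x|A mA].
  exists setT; first by split=> //; exact: openT.
  by rewrite -ge0_fin_numE ?muE ?outer_fin_num ?outer_ge0.
apply/eqP; rewrite eq_le; apply/andP; split; last first.
  by apply: ge_ereal_sup => _ [K [_ KA] <-]; exact: outer_mono.
apply/lee_addgt0Pr => e e0.
have [V [oV AV contentV]] := outer_regular (~` A) e0.
have mV : measurable (V : set (borelType T)) by exact: measurable_open.
have total (B : set (borelType T)) : measurable B -> mu B + mu (~` B) = mu setT.
  move=> mB; rewrite -(setUv B); apply/esym/measureU => //.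
    exact: measurableC.
  exact: setICr.
have cA := total A mA; rewrite -(total V mV) in cA.
have VA : ~` V `<=` A by move=> x nVx; apply: contrapT => /AV.
have supVA : mu (~` V) <= ereal_sup [set mu K | K in [set K : set T | compact K /\ K `<=` A]].
  apply: ereal_sup_ubound; exists (~` V) => //; split=> //.
  by apply: subclosed_compact compactT _ => //; exact: open_closedC.
apply: le_trans (leeD2r e%:E supVA).
rewrite -(outer_open oV) in contentV.
move: cA contentV; rewrite !muE.
have fin B : riesz_outer B = (fine (riesz_outer B))%:E by rewrite fineK ?outer_fin_num.
rewrite (fin A) (fin (~` A)) (fin V) (fin (~` V)) -!EFinD => -[cA]; rewrite !lee_fin.
lra.
Qed.

Let integrable_Cplus (f : Cplus T R) :
  mu.-integrable setT (EFin \o (f : borelType T -> R)).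
Proof.
have [N fN] := Cplus_bounded f compactT.
apply: measurable_bounded_integrable => //.
- by rewrite -ge0_fin_numE ?muE ?outer_fin_num ?outer_ge0.
- apply: (measurability _ (RGenOpens.measurableE R)).
  move=> _ [_ [a [b ->] <-]]; rewrite setTI; apply: measurable_open.
  by apply: open_comp => [x _|]; [exact: Cplus_continuous | exact: interval_open].
- exists N%:R; split=> // M NM x _ /=.
  by rewrite ger0_norm ?Cplus_ge0 // (le_trans (fN x)) // ltW.
Qed.

Lemma riesz_representation :
  exists m : {finite_measure set (borelType T) -> \bar R},
    radon m /\ forall f : Cplus T R, (L f)%:E = \int[m]_x (f x)%:E.
Proof.
exists mu; split=> [|f]; first exact: riesz_measure_radon.
pose I (g : Cplus T R) : R := (\int[mu]_x (g x))%R.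
have I_pa : positive_additive I.
  split=> [g|g h]; first by apply: Rintegral_ge0 => x _; exact: Cplus_ge0.
  by apply: RintegralD => //; exact: integrable_Cplus.
have LI : L =1 I.
  apply: (@sandwich_unique T R (fun V => fine (open_content V))) => //.
    move=> V g oV; split=> [Vg|Vg].
      by rewrite -lee_fin fineK ?content_fin_num // content_ge.
    by rewrite -lee_fin fineK ?content_fin_num // content_le_over.
  move=> V g oV.
  have mV : measurable (V : set (borelType T)) by exact: measurable_open.
  have IE : (I g)%:E = \int[mu]_x (g x)%:E.
    by rewrite /I /Rintegral fineK //; exact: integrable_fin_num (integrable_Cplus g).
  have VE : (fine (open_content V))%:E = \int[mu]_x (\1_V x)%:E.
    by rewrite fineK ?content_fin_num // integral_indic // setIT -(outer_open oV).
  have mg : measurable_fun [set: borelType T] (EFin \o (g : borelType T -> R)).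
    exact: measurable_int (integrable_Cplus g).
  have m1 : measurable_fun [set: borelType T] (EFin \o (\1_V : borelType T -> R)).
    exact/measurable_EFinP/measurable_indic.
  split=> Vg; rewrite -lee_fin IE VE; apply: ge0_le_integral => //= x _;
    rewrite lee_fin ?Cplus_ge0 // indicE.
    case: Vg => g1 g0; have [/set_mem|/negP nVx] := boolP (x \in V).
      by rewrite g1.
    by rewrite g0 // => /mem_set.
  by have [/set_mem/Vg//|_] := boolP (x \in V); rewrite Cplus_ge0.
by rewrite LI /I /Rintegral fineK //; exact: integrable_fin_num (integrable_Cplus f).
Qed.

End riesz.

(** * Representation of multiadditive functionals *)

(* The second conjunct is the case of an empty X^n, whose only measure is 0. *)
Theorem theorem4p2 (R : realType) (X : topologicalType)
    (compactX : compact [set: X]) (hausdorffX : hausdorff_space X)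
    (n : nat) (F : ('I_n -> Cplus X R) -> R)
    (F_ge0 : forall f, 0 <= F f) (F_additive : multiadditive F) :
  (forall p : {ptws 'I_n -> X},
    exists mu : {finite_measure set (borelType (pointed_at p)) -> \bar R},
      radon mu /\
      forall f : 'I_n -> Cplus X R,
        ((F f)%:E = \int[mu]_x (\prod_(i < n) f i (x i))%:E)%E) /\
  ([set: {ptws 'I_n -> X}] = set0 -> forall f, F f = 0).
Proof.
split=> [p|Y0 f].
  have [mu [radon_mu muP]] := @riesz_representation R (pointed_at p)
    (tensor_extension F) (power_compact compactX) (power_hausdorff hausdorffX)
    (tensor_extension_pa compactX hausdorffX F_ge0 F_additive p).
  exists mu; split=> // f.
  by rewrite -(tensor_extensionE compactX F_ge0 F_additive p) muP.
(* If X^n is empty then so is X and n > 0: an entry of f is the zero function. *)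
have X0 (x : X) : False.
  have : [set: {ptws 'I_n -> X}] (fun=> x) by [].
  by rewrite Y0.
have [[i _]|noi] := pselect (exists i : 'I_n, True); last first.
  have empty_ord (i : 'I_n) : False by apply: noi; exists i.
  have : [set: {ptws 'I_n -> X}] (fun i => False_rect X (empty_ord i)) by [].
  by rewrite Y0.
have := pa_eq0 (multiadditive_slot F_ge0 F_additive i f ler01) (f := f i).
have -> : dfwith f i (f i) = f.
  apply/funext => j; have [<-|ij] := eqVneq i j; first by rewrite dfwithin.
  by rewrite dfwithout.
by rewrite mul1r; apply=> x; case: (X0 x).
Qed.
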